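(* Let $\mathbb{K}$ be a field of characteristic zero and $X$ an alphabet. An element $P=\sum_{\underline{x}\in X^*} M^{\underline{x}}\,\underline{x}\in \mathbb{K}\langle\langle X\rangle\rangle$ is primitive for the coproduct $\Delta$, i.e. $\Delta(P)=P\otimes 1+1\otimes P$, if and only if the associated mould $M^\bullet$ is an alternal mould.
   Context: $X^*$ is the set of words (finite sequences) of letters of $X$, including the empty word $\emptyset=1$. $\mathbb{K}\langle\langle X\rangle\rangle$ is the $\mathbb{K}$-algebra of non-commutative formal power series on $X$. The coproduct $\Delta$ on $\mathbb{K}\langle\langle X\rangle\rangle$ is defined on letters by $\Delta(x)=x\otimes 1+1\otimes x$ for all $x\in X$, on words by $\Delta(\underline{x}^1\underline{x}^2)=\Delta(\underline{x}^1)\Delta(\underline{x}^2)$ for all $\underline{x}^1,\underline{x}^2\in X^*$, and is extended by linearity; in particular $\Delta(\emptyset)=\Delta(1)=1\otimes 1$. A mould on $X$ with values in $\mathbb{K}$ is a map $M^\bullet:X^*\to\mathbb{K}$, $\underline{x}\mapsto M^{\underline{x}}$; the mould associated with $\sum_{\underline{x}} M^{\underline{x}}\,\underline{x}$ is its family of coefficients. For words $\underline{x}^1,\underline{x}^2$, $\mathrm{sh}(\underline{x}^1,\underline{x}^2)$ (shuffle) is the set of sequences obtained by mixing the elements of the two sequences $\underline{x}^1$ and $\underline{x}^2$ while preserving the internal order of each. The mould $M^\bullet$ is called alternal if $\sum_{\underline{x}\in \mathrm{sh}(\underline{x}^1,\underline{x}^2)} M^{\underline{x}}=0$ for all $\underline{x}^1,\underline{x}^2\in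 X^*\setminus\{1\}$, i.e. for all non-empty words.
   Formalization: The condition that the constant term $M^{\emptyset}$ is 0 is added to ''alternal'': $P=1$ has an alternal mould but $\Delta(1)=1\otimes 1$ is not $1\otimes 1+1\otimes 1$. Shuffles in $\mathrm{sh}$ are counted with multiplicity. *)

(* Defs.v *)
From mathcomp Require Import all_boot all_algebra.
From mathcomp Require Import boolp classical_sets functions cardinality fsbigop.

Set Implicit Arguments.
Unset Strict Implicit.
Unset Printing Implicit Defensive.

Import GRing.Theory.
Local Open Scope ring_scope.

Section Series.
Variables (K : fieldType) (X : choiceType).
Implicit Types (u v w : seq X) (x y : X).

(* P : ncseries stands for the formal sum of the (P w) w over all words w. *)
Definition ncseries := seq X -> K.

(* The completed tensor square of ncseries: D : ncseries2 stands for the formal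
   sum of the D (u, v) (u (x) v).  For infinite series the coproduct does not in
   general lie in the algebraic tensor square, which embeds in this space. *)
Definition ncseries2 := seq X * seq X -> K.

Definition mould := seq X -> K.

Definition mould_of (P : ncseries) : mould := fun w => P w.

Definition word_series (w : seq X) : ncseries := fun u => (u == w)%:R.

Definition series_one : ncseries := word_series [::].

Definition series_mul (P Q : ncseries) : ncseries :=
  fun u => \sum_(i < (size u).+1) P (take i u) * Q (drop i u).

Definition tensor (P Q : ncseries) : ncseries2 := fun uv => P uv.1 * Q uv.2.

(* The product (a (x) b) (c (x) d) = ac (x) bd; see tensor_mul. *)
Definition series2_mul (D E : ncseries2) : ncseries2 := fun uv =>
  \sum_(i < (size uv.1).+1) \sum_(j < (size uv.2).+1)
    D (take i uv.1, take j uv.2) * E (drop i uv.1, drop j uv.2).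

Definition coproduct_letter (x : X) : ncseries2 :=
  tensor (word_series [:: x]) series_one
  \+ tensor series_one (word_series [:: x]).

Definition coproduct_word (w : seq X) : ncseries2 :=
  foldr (fun x => series2_mul (coproduct_letter x))
        (tensor series_one series_one) w.

(* The sum has finite support (coproduct_support), so that the value 0 given by
   convention to sums of infinite support is never used. *)
Definition coproduct (P : ncseries) : ncseries2 := fun uv =>
  \sum_(w \in [set: seq X]) P w * coproduct_word w uv.

Definition primitive (P : ncseries) : Prop :=
  coproduct P = tensor P series_one \+ tensor series_one P.

(* The shuffles of u and v, listed with multiplicity: a word occurs once for
   each way of obtaining it by mixing u and v; see count_shuffle. *)
Fixpoint shuffle (u : seq X) : seq X -> seq (seq X) :=
  fix shuffle_u (v : seq X) : seq (seq X) :=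
    match u, v with
    | [::], _ => [:: v]
    | _, [::] => [:: u]
    | x :: u', y :: v' =>
        [seq x :: w | w <- shuffle u' v] ++ [seq y :: w | w <- shuffle_u v']
    end.

(* No condition on the value M [::]: the constant series 1 has an alternal mould
   in this sense but is not primitive (alternal_one, not_primitive_one).  A
   primitive series has zero constant term, hence primitivity is to be compared
   with alternality together with M [::] = 0. *)
Definition alternal (M : mould) : Prop :=
  forall u v : seq X, u <> [::] -> v <> [::] ->
    \sum_(w <- shuffle u v) M w = 0.

Lemma tensor_mul (P Q P' Q' : ncseries) :
  series2_mul (tensor P Q) (tensor P' Q') =
  tensor (series_mul P P') (series_mul Q Q').
Proof.
apply/funext => -[u v]; rewrite /series2_mul /tensor /series_mul /=.
rewrite big_distrlr /=; apply: eq_bigr => i _; apply: eq_bigr => j _.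
by rewrite mulrACA.
Qed.

Lemma series2_mul1l (E : ncseries2) :
  series2_mul (tensor series_one series_one) E = E.
Proof.
have t0 (s : seq X) (i : 'I_(size s)) : (take i.+1 s == [::]) = false.
  by case: s i => [[]|].
apply/funext => -[u v]; rewrite /series2_mul /tensor /series_one /word_series /=.
rewrite big_ord_recl /= big_ord_recl /= !take0 !drop0 eqxx !mul1r.
rewrite !big1 ?addr0 // => i _; last by rewrite t0 mulr0 mul0r.
by rewrite big1 // => j _; rewrite t0 !mul0r.
Qed.

Lemma coproduct_letter_mul x (E : ncseries2) u v :
  series2_mul (coproduct_letter x) E (u, v) =
    (if u is y :: u' then (y == x)%:R * E (u', v) else 0)
    + (if v is y :: v' then (y == x)%:R * E (u, v') else 0).
Proof.
have t0 (s : seq X) (i : 'I_(size s)) : (take i.+1 s == [::]) = false.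
  by case: s i => [[]|].
have S1 s (F : seq X -> K) : \sum_(i < (size s).+1)
    (take i s == [::])%:R * F (drop i s) = F s.
  rewrite big_ord_recl /= take0 drop0 eqxx mul1r big1 ?addr0 // => i _.
  by rewrite t0 // mul0r.
have Sx s (F : seq X -> K) : \sum_(i < (size s).+1)
    (take i s == [:: x])%:R * F (drop i s) =
    if s is y :: s' then (y == x)%:R * F s' else 0.
  rewrite big_ord_recl /= take0 mul0r add0r; case: s => [|y s] /=.
    by rewrite big_ord0.
  under eq_bigr do rewrite /= eqseq_cons -mulnb natrM -mulrA.
  by rewrite -big_distrr /= S1.
rewrite /series2_mul /coproduct_letter /tensor /series_one /word_series /=.
under eq_bigr do under eq_bigr do rewrite mulrDl.
under eq_bigr do rewrite big_split /=.
rewrite big_split /=; congr (_ + _).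
  under eq_bigr do under eq_bigr do rewrite -mulrA.
  under eq_bigr do rewrite -big_distrr (S1 v (fun t => E (_, t))) /=.
  exact: (Sx u (fun t => E (t, v))).
under eq_bigr do under eq_bigr do rewrite -mulrA.
under eq_bigr do rewrite -big_distrr (Sx v (fun t => E (_, t))) /=.
by rewrite (S1 u (fun t => if v is y :: v' then (y == x)%:R * E (t, v') else 0)).
Qed.

Lemma coproduct_letter_mulA x (D E : ncseries2) :
  series2_mul (series2_mul (coproduct_letter x) D) E =
  series2_mul (coproduct_letter x) (series2_mul D E).
Proof.
apply/funext => -[u v]; rewrite coproduct_letter_mul {1}/series2_mul /=.
under eq_bigr do under eq_bigr do rewrite coproduct_letter_mul mulrDl.
under eq_bigr do rewrite big_split /=.
rewrite big_split /=; congr (_ + _).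
  rewrite big_ord_recl /= take0 big1 ?add0r; last by move=> *; rewrite mul0r.
  case: u => [|y u]; first by rewrite big_ord0.
  rewrite /series2_mul big_distrr /=; apply: eq_bigr => i _.
  by rewrite big_distrr /=; apply: eq_bigr => j _; rewrite mulrA.
rewrite exchange_big /=.
rewrite big_ord_recl /= take0 big1 ?add0r; last by move=> *; rewrite mul0r.
case: v => [|y v]; first by rewrite big_ord0.
rewrite /series2_mul exchange_big /= big_distrr /=; apply: eq_bigr => i _.
by rewrite big_distrr /=; apply: eq_bigr => j _; rewrite mulrA.
Qed.

Lemma coproduct_word_nil :
  coproduct_word [::] = tensor series_one series_one.
Proof. by []. Qed.

Lemma coproduct_word_letter x : coproduct_word [:: x] = coproduct_letter x.
Proof.
apply/funext => -[u v]; rewrite /= coproduct_letter_mul.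
rewrite /coproduct_letter /tensor /series_one /word_series /=.
congr (_ + _).
  case: u => [|y u]; first by rewrite mul0r.
  by rewrite eqseq_cons -mulnb natrM mulrA.
case: v => [|y v]; first by rewrite mulr0.
by rewrite eqseq_cons -mulnb natrM mulrCA.
Qed.

Lemma coproduct_word_cat u v :
  coproduct_word (u ++ v) = series2_mul (coproduct_word u) (coproduct_word v).
Proof.
elim: u => [|x u IHu] /=; first by rewrite series2_mul1l.
by rewrite IHu coproduct_letter_mulA.
Qed.

Lemma coproduct_support uv :
  finite_set [set w : seq X | coproduct_word w uv != 0]%classic.
Proof.
case: uv => u v; have [n] := ubnP (size u + size v).
elim: n u v => // n IHn u v /ltnSE le_uv.
pose S (s t : seq X) := [set w : seq X | coproduct_word w (s, t) != 0]%classic.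
have finS (s : seq X) t y : finite_set (S s t) ->
    finite_set [set y :: w | w in S s t]%classic.
  exact: finite_image.
pose A := if u is y :: u' then [set y :: w | w in S u' v]%classic else set0.
pose B := if v is y :: v' then [set y :: w | w in S u v']%classic else set0.
apply: (@sub_finite_set _ _ ([set [::]] `|` (A `|` B))%classic); last first.
  rewrite !finite_setU; split; first exact: finite_set1; split.
    rewrite /A; case: {A B} u le_uv => [|y u] le_uv; first exact: finite_set0.
    by apply/finS/IHn.
  rewrite /B; case: {A B} v le_uv => [|y v] le_uv; first exact: finite_set0.
  by apply/finS/IHn; move: le_uv; rewrite /= addnS.
case=> [|x w] /=; first by left.
rewrite coproduct_letter_mul => nz; right.
have [zA|nzA] := eqVneq (if u is y :: u' then
    (y == x)%:R * coproduct_word w (u', v) else 0) 0.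
  right; move: nz; rewrite zA add0r /B; case: (v) => [|y v']; rewrite ?eqxx //.
  have [->|] := eqVneq y x; last by rewrite mul0r eqxx.
  by rewrite mul1r => nzw; exists w.
left; move: nzA; rewrite /A; case: (u) => [|y u']; rewrite ?eqxx //.
have [->|] := eqVneq y x; last by rewrite mul0r eqxx.
by rewrite mul1r => nzw; exists w.
Qed.

Lemma count_shuffle u v w :
  count_mem w (shuffle u v) =
  #|[set m : (size w).-tuple bool |
      (mask m w == u) && (mask (map negb m) w == v)]|.
Proof.
elim: w u v => [|x w IHw] u v.
  have -> : count_mem [::] (shuffle u v) = (([::] == u) && ([::] == v)) :> nat.
    case: u v => [|a u] [|b v] //=; rewrite count_cat !count_map.
    by rewrite !(@eq_count _ _ pred0) ?count_pred0.
  case: eqP => [<-|] /=; first case: eqP => [<-|] /=.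
  - apply/esym/eqP/cards1P; exists [tuple]; apply/setP => m.
    by rewrite !inE [m]tuple0 !eqxx.
  - move=> nv; apply/esym/eqP; rewrite cards_eq0; apply/eqP/setP => m.
    by rewrite !inE [m]tuple0 /=; apply/eqP.
  - move=> nu; apply/esym/eqP; rewrite cards_eq0; apply/eqP/setP => m.
    by rewrite !inE [m]tuple0 /=; case: eqP.
pose N s t := #|[set m : (size w).-tuple bool |
  (mask m w == s) && (mask (map negb m) w == t)]|.
have -> : count_mem (x :: w) (shuffle u v) =
    ((if u is a :: u' then (a == x) * N u' v else 0)
    + (if v is b :: v' then (b == x) * N u v' else 0))%N.
  have cc a s : count_mem (x :: w) (map (cons a) s) =
      ((a == x) * count_mem w s)%N.
    rewrite count_map; have [->|/negPf ne] := eqVneq a x.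
      by rewrite mul1n; apply: eq_count => t /=; rewrite eqseq_cons eqxx.
    rewrite mul0n -(count_pred0 s); apply: eq_count => t /=.
    by rewrite eqseq_cons ne.
  have sh0l s : shuffle [::] s = [:: s] by case: s.
  have sh0 s : shuffle s [::] = [:: s] by case: s.
  case: u v => [|a u] [|b v].
  - by [].
  - rewrite add0n /N -IHw !sh0l /= !addn0 eqseq_cons.
    by case: (b == x); rewrite ?mul1n ?mul0n.
  - by rewrite addn0 /N -IHw !sh0 /= !addn0 eqseq_cons;
      case: (a == x); rewrite ?mul1n ?mul0n.
  - by rewrite /N -!IHw -!cc -count_cat.
rewrite -!sum1_card.
pose f b (m : (size w).-tuple bool) : (size (x :: w)).-tuple bool :=
  [tuple of b :: m].
rewrite (bigID (fun m : (size (x :: w)).-tuple bool => thead m)) /=.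
congr (_ + _)%N.
  rewrite (reindex_onto (f true) (fun m => [tuple of behead m])) /=; last first.
    move=> m /andP[_ hm]; rewrite [RHS]tuple_eta.
    by apply/val_inj; rewrite /= hm.
  case: u => [|a u]; first by rewrite big1 // => m; rewrite !inE.
  have [->|ne] := eqVneq a x.
    rewrite mul1n /N -sum1_card; apply: eq_bigl => m.
    rewrite !inE /= eqseq_cons eqxx /=.
    have -> : [tuple of behead (f true m)] = m by apply/val_inj.
    by rewrite eqxx !andbT.
  rewrite mul0n big1 // => m.
  by rewrite !inE /= eqseq_cons [x == a]eq_sym (negPf ne).
rewrite (reindex_onto (f false) (fun m => [tuple of behead m])) /=; last first.
  move=> m /andP[_ /negPf hm]; rewrite [RHS]tuple_eta.
  by apply/val_inj; rewrite /= hm.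
case: v => [|a v]; first by rewrite big1 // => m; rewrite !inE /= andbF.
have [->|ne] := eqVneq a x.
  rewrite mul1n /N -sum1_card; apply: eq_bigl => m.
  rewrite !inE /= eqseq_cons eqxx /=.
  have -> : [tuple of behead (f false m)] = m by apply/val_inj.
  by rewrite eqxx !andbT.
rewrite mul0n big1 // => m.
by rewrite !inE /= eqseq_cons [x == a]eq_sym (negPf ne) andbF.
Qed.

Lemma alternal_one : alternal (mould_of series_one).
Proof.
case=> [|x u] [|y v] // _ _.
by rewrite big_cat !big_map /= !big1 ?addr0 // => w _; rewrite /mould_of.
Qed.

Lemma not_primitive_one : ~ primitive series_one.
Proof.
move=> /(congr1 (fun D : ncseries2 => D ([::], [::]))).
rewrite /coproduct -(fsbig_widen [set [::]]%classic) //; last first.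
  move=> w [_ /= /eqP /negPf nw].
  by rewrite /series_one /word_series nw mul0r.
rewrite fsbig_set1.
rewrite /tensor /series_one /word_series /= mul1r mulr1 => one_eq2.
have /eqP : 1 + 1 = 1 + 0 :> K.
  by rewrite addr0; move: one_eq2; rewrite /tensor /= mulr1 => <-.
by rewrite (inj_eq (addrI _)) oner_eq0.
Qed.

End Series.

(* Main.v *)
Require Import Defs.
From mathcomp Require Import all_boot all_algebra.
From mathcomp Require Import boolp classical_sets functions cardinality fsbigop.

(** The coproduct of a word is the sum of all its deconcatenations into a pair
of complementary subwords, so the coefficient of u (x) v in the coproduct of w
is the number of ways of obtaining w by shuffling u and v: both numbers obey
the same recursion on the first letter of w ([coproduct_word_shuffle]).
Dually, the coefficient of u (x) v in the coproduct of P is the sum of the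
coefficients of P over the shuffles of u and v ([coproduct_shuffle]).

Primitivity is now read coefficient by coefficient.  If u and v are non-empty,
then P (x) 1 + 1 (x) P has coefficient 0 at u (x) v, and the equation is
exactly alternality.  If one of the two words is empty, their only shuffle is
the other one, and the equation says that the constant term of P vanishes when
both are empty and is otherwise automatic. *)

Import GRing.Theory.
Local Open Scope ring_scope.

Lemma shuffle0w (X : choiceType) (v : seq X) : shuffle [::] v = [:: v].
Proof. by case: v. Qed.

Lemma shufflew0 (X : choiceType) (u : seq X) : shuffle u [::] = [:: u].
Proof. by case: u. Qed.

Lemma count_map_cons (X : eqType) (x y : X) (w : seq X) (s : seq (seq X)) :
  count_mem (x :: w) [seq y :: t | t <- s] = ((y == x) * count_mem w s)%N.
Proof.
rewrite count_map; have [->|/negPf ne] := eqVneq y x.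
  by rewrite mul1n; apply: eq_count => t /=; rewrite eqseq_cons eqxx.
rewrite mul0n -(count_pred0 s); apply: eq_count => t /=.
by rewrite eqseq_cons ne.
Qed.

(** A shuffle of y :: u and z :: v with first letter x arises from a shuffle of
u and z :: v if x = y, and from a shuffle of y :: u and v if x = z (counting
both if x = y = z).  Multiplication on the left by x (x) 1 + 1 (x) x removes
first letters in the same way, whence the induction on w. *)
Lemma coproduct_word_shuffle (K : fieldType) (X : choiceType)
    (w u v : seq X) :
  coproduct_word K w (u, v) = (count_mem w (shuffle u v))%:R.
Proof.
elim: w u v => [|x w IHw] u v.
  rewrite /= /tensor /series_one /word_series /=.
  case: u v => [|a u] [|b v] /=; rewrite ?mul0r ?mulr0 ?mul1r //.
  by rewrite count_cat !count_map !(@eq_count _ _ pred0) ?count_pred0.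
rewrite /= coproduct_letter_mul; case: u v => [|a u] [|b v].
- by rewrite addr0.
- by rewrite add0r IHw !shuffle0w /= !addn0 eqseq_cons -natrM mulnb.
- by rewrite addr0 IHw !shufflew0 /= !addn0 eqseq_cons -natrM mulnb.
- by rewrite !IHw /= count_cat !count_map_cons natrD !natrM.
Qed.

(** The words contributing to the coefficient of u (x) v are the shuffles of u
and v, a finite set, so the infinite sum defining the coproduct reduces to a
finite one; the multiplicities become repetitions in the list of shuffles. *)
Lemma coproduct_shuffle (K : fieldType) (X : choiceType) (P : ncseries K X)
    (u v : seq X) :
  coproduct P (u, v) = \sum_(w <- shuffle u v) P w.
Proof.
rewrite /coproduct -(fsbig_widen [set` undup (shuffle u v)]%classic) //; last first.
  move=> w [_ /=]; rewrite mem_undup => /negP nw.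
  by rewrite coproduct_word_shuffle (count_memPn nw) mulr0.
rewrite -fsbig_seq ?undup_uniq // -[RHS]big_undup_iterop_count.
(* Counted with multiplicity, P w *+ n is by definition the n-fold sum of P w. *)
by apply: eq_bigr => w _; rewrite coproduct_word_shuffle mulr_natr.
Qed.

Theorem mainTheorem1 (K : fieldType) (char0 : [pchar K] =i pred0)
    (X : choiceType) (P : ncseries K X) :
  primitive P <-> mould_of P [::] = 0 /\ alternal (mould_of P).
Proof.
rewrite /primitive /mould_of; split.
  move=> primP.
  have coefP u v : \sum_(w <- shuffle u v) P w =
      P u * (v == [::])%:R + (u == [::])%:R * P v.
    by rewrite -coproduct_shuffle primP.
  split=> [|u v /eqP/negPf u0 /eqP/negPf v0].
    have /eqP := coefP [::] [::].
    by rewrite big_seq1 mulr1 mul1r addrC -subr_eq subrr eq_sym => /eqP.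
  by rewrite coefP u0 v0 mulr0 mul0r addr0.
move=> [P0 altP]; apply/funext => -[u v]; rewrite coproduct_shuffle.
rewrite /= /tensor /series_one /word_series /=.
have [->|/eqP u0] := eqVneq u [::].
  by rewrite shuffle0w big_seq1 P0 mul0r add0r mul1r.
have [->|/eqP v0] := eqVneq v [::].
  by rewrite shufflew0 big_seq1 P0 mulr0 addr0 mulr1.
by rewrite altP // mulr0 mul0r addr0.
Qed.
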